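(* There are no $K_5$ descendants of level $1$; that is, no $K_5$ descendant $G$ satisfies (number of vertices of $G$) $-$ (number of triangles of $G$) $=1$.
   Context: Graphs are finite, simple and undirected. Double triangle expansion (DTE): let $G$ be a $4$-regular graph containing four distinct vertices $v_1,v_2,v_3,v_4$ such that $\{v_1,v_2,v_3\}$ is a triangle and $\{v_2,v_4\}$ is an edge. The DTE of $G$ at this subgraph is obtained by deleting the edges $\{v_1,v_3\}$ and $\{v_2,v_4\}$ and adding one new vertex adjacent to exactly $v_1,v_2,v_3,v_4$. A $K_5$ descendant is a graph obtained from $K_5$ by a finite (possibly empty) sequence of DTEs. The level of a graph $G$ is $L(G)=$ (number of vertices of $G$) $-$ (number of triangles of $G$). *)

(* Defs.v *)
From HB Require Import structures.
From mathcomp Require Import all_boot all_order all_algebra.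

Set Implicit Arguments.
Unset Strict Implicit.
Unset Printing Implicit Defensive.

Record sgraph := SGraph {
  vertex :> finType;
  adj : rel vertex;
  adj_sym : symmetric adj;
  adj_irrefl : irreflexive adj }.

Definition isomorphic (G H : sgraph) : Prop :=
  exists2 f : G -> H, bijective f & forall x y, adj (f x) (f y) = adj x y.

Definition regular (k : nat) (G : sgraph) : Prop :=
  forall x : G, #|[set y | adj x y]| = k.

Definition is_triangle (G : sgraph) (A : {set G}) : bool :=
  (#|A| == 3) && [forall x in A, forall y in A, (x != y) ==> adj x y].

Definition num_triangles (G : sgraph) : nat := #|[set A : {set G} | is_triangle A]|.

(* Integer-valued, since the level can be negative: K_5 has level 5 - 10. *)
Definition level (G : sgraph) : int := (#|G|%:Z - (num_triangles G)%:Z)%R.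

Section Complete.
Variable n : nat.

Definition complete_adj : rel 'I_n := fun x y => x != y.

Lemma complete_adj_sym : symmetric complete_adj.
Proof. by move=> x y; rewrite /complete_adj eq_sym. Qed.

Lemma complete_adj_irrefl : irreflexive complete_adj.
Proof. by move=> x; rewrite /complete_adj eqxx. Qed.

Definition complete : sgraph := SGraph complete_adj_sym complete_adj_irrefl.
End Complete.

Section DTE.
Variables (G : sgraph) (v1 v2 v3 v4 : G).

Definition dte_site : Prop :=
  [/\ uniq [:: v1; v2; v3; v4], is_triangle [set v1; v2; v3] & adj v2 v4].

(* [None] is the new vertex. *)
Definition dte_adj : rel (option G) := fun x y =>
  match x, y with
  | Some u, Some w =>
      [&& adj u w, [set u; w] != [set v1; v3] & [set u; w] != [set v2; v4]]
  | Some u, None | None, Some u => u \in [set v1; v2; v3; v4]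
  | None, None => false
  end.

Lemma dte_adj_sym : symmetric dte_adj.
Proof. by move=> [u|] [w|] //=; rewrite adj_sym setUC. Qed.

Lemma dte_adj_irrefl : irreflexive dte_adj.
Proof. by move=> [u|] //=; rewrite adj_irrefl. Qed.

Definition dte : sgraph := SGraph dte_adj_sym dte_adj_irrefl.
End DTE.

(* Graphs are considered up to isomorphism: the vertex set of a descendant may
   be any finite type. *)
Inductive K5_descendant : sgraph -> Prop :=
| K5_descendant_base (H : sgraph) :
    isomorphic (complete 5) H -> K5_descendant H
| K5_descendant_step (G H : sgraph) (v1 v2 v3 v4 : G) :
    K5_descendant G -> regular 4 G -> dte_site v1 v2 v3 v4 ->
    isomorphic (dte v1 v2 v3 v4) H -> K5_descendant H.

(* Main.v *)
Require Import Defs.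
From mathcomp Require Import all_boot all_order all_algebra.
From mathcomp Require Import zify.

Set Implicit Arguments.
Unset Strict Implicit.
Unset Printing Implicit Defensive.

(** Every K5 descendant is either a zigzag graph, that is, the square of a cycle
    C_n with n >= 5 (vertices in cyclic order, adjacent when at distance at most
    two), or has level at least 2; and the level of a zigzag graph is at most 0,
    because its n triples of consecutive vertices are distinct triangles.

    Two facts make this dichotomy stable under double triangle expansion.

    First, an expansion never decreases the level ([dte_triangles_le]).  One
    vertex is added, so at most one triangle may be gained.  A new triangle
    consists of the new vertex and one of the edges v1v2, v2v3, v1v4, v3v4.
    Leaving v1v2 aside, these are matched with the destroyed triangles v1v2v3,
    v1v2v4, v2v3v4 respectively.  Any further triangle through v1v3 or v2v4 is
    lost without replacement and raises the level by one.

    Second, take an expansion of the zigzag graph on n vertices.  If v1, v2, v3,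
    v4 are consecutive along some zigzag cycle, then the new vertex can be
    inserted in that cycle between v2 and v3, which gives the zigzag graph on
    n + 1 vertices ([zigzag_insert]).  For n = 5 and n = 6 every site is of this
    kind for a suitable choice of the cycle: for n = 5 the graph is complete, and
    for n = 6 it is the octahedron, whose adjacency is determined by the pairs of
    antipodes.  For n >= 7 the cycle is rigid, the triangles are exactly the
    triples of consecutive vertices, and so the level is 0.  Then a site is
    either consecutive, up to reversing the cycle or exchanging v1 and v3, or
    else v2 is an end of the triangle v1v2v3; in that case v1v3 and v2v4 each
    lie in one more triangle that is lost, and the level becomes at least 2. *)

(** * Triangles *)

Lemma adj_neq (G : sgraph) (x y : G) : adj x y -> x != y.
Proof. by apply: contraTneq => ->; rewrite adj_irrefl. Qed.

Lemma triangle3 (G : sgraph) (x y z : G) :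
  adj x y -> adj x z -> adj y z -> is_triangle [set x; y; z].
Proof.
move=> xy xz yz; have [nxy nxz nyz] := And3 (adj_neq xy) (adj_neq xz) (adj_neq yz).
rewrite /is_triangle setUC cardsU1 !inE cards2 nxy.
rewrite (eq_sym z) (eq_sym z) (negPf nxz) (negPf nyz) /=.
apply/forall_inP => a; rewrite !inE => /orP[/eqP->|/orP[]/eqP->];
apply/forall_inP => b; rewrite !inE => /orP[/eqP->|/orP[]/eqP->];
by rewrite ?eqxx // ?xy ?xz ?yz 1?adj_sym ?xy ?xz ?yz ?implybT.
Qed.

Lemma mem_triangle_adj (G : sgraph) (A : {set G}) x y :
  is_triangle A -> x \in A -> y \in A -> x != y -> adj x y.
Proof.
by case/andP=> _ /forall_inP tA xA yA; apply/implyP; apply: (forall_inP (tA x xA)).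
Qed.

Lemma triangle_at (G : sgraph) (A : {set G}) x : is_triangle A -> x \in A ->
  exists y z, [/\ adj x y, adj x z, adj y z & A = [set x; y; z]].
Proof.
move=> tA xA; have /andP[/eqP cA _] := tA.
have /cards2P[y [z [nyz eqA]]] : #|A :\ x| == 2.
  by move: cA; rewrite (cardsD1 x) xA add1n => -[->].
have /andP[nyx yA] : (y != x) && (y \in A) by rewrite -in_setD1 eqA !inE eqxx.
have /andP[nzx zA] : (z != x) && (z \in A).
  by rewrite -in_setD1 eqA !inE eqxx orbT.
exists y, z; split; try by apply: (mem_triangle_adj tA); rewrite // eq_sym.
by rewrite -setUA -eqA setD1K.
Qed.

Lemma triangleP (G : sgraph) (A : {set G}) :
  reflect (exists x y z, [/\ adj x y, adj x z, adj y z & A = [set x; y; z]])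
          (is_triangle A).
Proof.
apply: (iffP idP) => [tA|[x [y [z [xy xz yz ->]]]]]; last exact: triangle3.
have /card_gt0P[x xA] : 0 < #|A| by case/andP: tA => /eqP->.
by exists x; apply: triangle_at.
Qed.

Definition triangles (G : sgraph) : {set {set G}} := [set A | is_triangle A].

Lemma num_triangles_iso (G H : sgraph) : isomorphic G H ->
  num_triangles G = num_triangles H.
Proof.
move=> [f [g fK gK] adjf]; rewrite /num_triangles.
rewrite -(card_imset _ (imset_inj (can_inj fK))); congr #|pred_of_set _|.
apply/setP=> B; rewrite inE; apply/imsetP/idP => [[A + ->]|tB].
  rewrite inE => /triangleP[x [y [z [xy xz yz ->]]]].
  by rewrite !imsetU !imset_set1; apply: triangle3; rewrite adjf.
exists (g @: B); last by rewrite -imset_comp (eq_imset _ gK) imset_id.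
rewrite inE; case/triangleP: tB => x [y [z [xy xz yz ->]]].
by rewrite !imsetU !imset_set1; apply: triangle3; rewrite -adjf !gK.
Qed.

(** * Maps with a single cycle *)

Section Cycle.
Variables (T : finType) (s : T -> T).
Hypothesis cyc : forall x y, fconnect s x y.

Lemma cycle_inj : injective s.
Proof.
apply/injectiveP/card_uniqP; rewrite size_codom; apply/eq_card => y; rewrite inE.
have := cyc (s y) y; rewrite fconnect_orbit => /trajectP[i _ ->].
by rewrite -iterSr iterS; apply: codom_f.
Qed.

Lemma cycle_order x : order s x = #|T|.
Proof. by apply: eq_card => y; rewrite inE; apply: cyc. Qed.

Lemma eq_iter_cycle x i j : i < #|T| -> j < #|T| ->
  (iter i s x == iter j s x) = (i == j).
Proof.
rewrite -(cycle_order x) => iT jT; have := orbit_uniq s x.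
rewrite -(nth_traject s iT) -(nth_traject s jT) => u.
by rewrite nth_uniq ?size_traject.
Qed.

Lemma cycle_iter x y : exists2 i, i < #|T| & y = iter i s x.
Proof.
by have := cyc x y; rewrite fconnect_orbit => /trajectP; rewrite cycle_order.
Qed.

Lemma cycle_iterV k y : exists x, y = iter k s x.
Proof.
have [i _ ->] := cycle_iter (iter k s y) y.
by exists (iter i s y); rewrite -!iterD addnC.
Qed.

Lemma iter_card_cycle x : iter #|T| s x = x.
Proof. by rewrite -(cycle_order x) iter_order //; apply: cycle_inj. Qed.

End Cycle.

(** * Zigzag graphs *)

Definition ahead2 (T : eqType) (s : T -> T) : rel T :=
  fun x y => (y == s x) || (y == s (s x)).

(** That [s] is a single cycle is expressed by saying that every point reaches
    every other one by iteration; on a finite type this makes [s] bijective. *)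
Definition zigzag_cycle (G : sgraph) (s : G -> G) : Prop :=
  (forall x y, fconnect s x y) /\ (forall x y, adj x y = ahead2 s x y || ahead2 s y x).

Definition zigzag (G : sgraph) : Prop :=
  5 <= #|G| /\ exists s : G -> G, zigzag_cycle s.

(** Reading the cycle backwards shows the same graph; this halves the number of
    sites to be inspected. *)
Lemma zigzag_cycle_finv (G : sgraph) (s : G -> G) :
  zigzag_cycle s -> zigzag_cycle (finv s).
Proof.
move=> [cyc adjs]; have injs := cycle_inj cyc; split=> x y.
  by rewrite same_fconnect_finv.
have finvE a b : (b == finv s a) = (a == s b).
  by rewrite -(inj_eq injs) f_finv // eq_sym.
have aheadV a b : ahead2 (finv s) a b = ahead2 s b a.
  by rewrite /ahead2 !finvE (eq_sym (finv s a)) finvE.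
by rewrite !aheadV adjs orbC.
Qed.

Lemma zigzag_iso (G H : sgraph) : isomorphic G H -> zigzag G -> zigzag H.
Proof.
move=> [f bijf adjf] [G5 [s [cyc adjs]]]; have [g fK gK] := bijf.
split; first by rewrite -(bij_eq_card bijf).
exists (f \o s \o g); split=> x y.
  have [i _ gy] := cycle_iter cyc (g x) (g y).
  have -> : y = iter i (f \o s \o g) x; last exact: fconnect_iter.
  rewrite -[y]gK gy; elim: i {gy} => [|i IH]; first by rewrite gK.
  by rewrite !iterS -IH /= fK.
rewrite -[x]gK -[y]gK adjf adjs /ahead2 /= !fK.
by rewrite !(inj_eq (can_inj fK)).
Qed.

(** * Triangles lost and gained in an expansion *)

Section Counting.
Variables (G : sgraph) (v1 v2 v3 v4 : G).
Hypothesis site : dte_site v1 v2 v3 v4.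

Definition lost_triangles : {set {set G}} :=
  [set A in triangles G | ([set v1; v3] \subset A) || ([set v2; v4] \subset A)].

Definition kept_triangles : {set {set G}} :=
  [set A in triangles G | ~~ (([set v1; v3] \subset A) || ([set v2; v4] \subset A))].

(** Those of these three sets that are triangles are destroyed by the expansion,
    but each is exchanged for a triangle through the new vertex. *)
Definition replaced_triangles : {set {set G}} :=
  [set [set v1; v2; v3]; [set v1; v2; v4]; [set v2; v3; v4]].

(** The new vertex takes the place of v1 in v1v2v3, and of v2 in v1v2v4 and in
    v2v3v4. *)
Definition replacement (A : {set G}) : {set option G} :=
  None |: Some @: (A :\ (if v4 \in A then v2 else v1)).

Lemma dte_adj_lost :
  ~~ dte_adj v1 v2 v3 v4 (Some v1) (Some v3) /\
  ~~ dte_adj v1 v2 v3 v4 (Some v2) (Some v4).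
Proof. by rewrite /dte_adj !eqxx !andbF. Qed.

(** The triangle formed by the new vertex with v1 and v2 is the only one that is
    neither inherited nor a replacement: the new vertex and two of its neighbours
    form a triangle only along v1v2, v2v3, v1v4 or v3v4, as the edges v1v3 and
    v2v4 have been deleted. *)
Lemma dte_triangles_cover : triangles (dte v1 v2 v3 v4) \subset
  [set None; Some v1; Some v2] |: ([set Some @: B | B : {set G} in kept_triangles] :|:
    replacement @: (lost_triangles :&: replaced_triangles)).
Proof.
have [n13 n24] := dte_adj_lost.
have [uv t123 e24] := site.
move: uv; rewrite /= !inE !negb_or !andbT.
case/and3P=> /and3P[d12 d13 d14] /andP[d23 d24] d34.
have adjS (a b : G) : adj (Some a : dte v1 v2 v3 v4) (Some b) -> adj a b.
  by case/and3P.
apply/subsetP => A; rewrite inE => tA; rewrite !inE.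
have [oA|oA] := boolP (None \in A); last first.
  apply/orP; right; apply/orP; left.
  have [x [y [z [xy xz yz eA]]]] := triangleP _ tA.
  case: x y z xy xz yz eA => [x|] [y|] [z|] xy xz yz eA;
    try by rewrite eA !inE eqxx ?orbT in oA.
  have eAS : A = Some @: [set x; y; z] by rewrite !imsetU !imset_set1.
  apply/imsetP; exists [set x; y; z] => //.
  rewrite !inE triangle3 ?adjS //=; apply/norP.
  have notin a b : a != b -> ~~ dte_adj v1 v2 v3 v4 (Some a) (Some b) ->
      ~~ ([set a; b] \subset [set x; y; z]).
    move=> nab; apply: contra; rewrite subUset !sub1set => /andP[ia ib].
    change (@adj (dte v1 v2 v3 v4) (Some a) (Some b)).
    by apply: (mem_triangle_adj tA) => //; rewrite eAS imset_f.
  by split; apply: notin.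
have [y [z [oy oz yz eA]]] := triangle_at tA oA.
case: y z oy oz yz eA => [y|] [z|] // oy oz yz eA.
have adjyz := adjS _ _ yz.
have inR (B : {set G}) : is_triangle B -> B \in replaced_triangles ->
    ([set v1; v3] \subset B) || ([set v2; v4] \subset B) -> A = replacement B ->
    A \in replacement @: (lost_triangles :&: replaced_triangles).
  by move=> tB rB lB ->; apply/imset_f; rewrite inE rB !inE tB lB.
have e12 : adj v1 v2 by apply: (mem_triangle_adj t123); rewrite ?inE ?eqxx ?orbT.
have e23 : adj v2 v3 by apply: (mem_triangle_adj t123); rewrite ?inE ?eqxx ?orbT.
suff [->|AR] : A = [set None; Some v1; Some v2] \/
    A \in replacement @: (lost_triangles :&: replaced_triangles).
- by rewrite eqxx.
- by rewrite AR !orbT.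
have p23 : A = [set None; Some v2; Some v3] ->
    A \in replacement @: (lost_triangles :&: replaced_triangles).
  move=> eA1; apply: (inR [set v1; v2; v3]);
    rewrite ?eA1 ?subUset ?sub1set ?inE ?eqxx ?orbT //.
  rewrite /replacement !inE !(eq_sym v4) (negPf d14) (negPf d24) (negPf d34) /=.
  by rewrite -[in RHS]setUA setU1K ?imsetU1 ?imset_set1 ?setUA // !inE negb_or d12.
have p14 : adj v1 v4 -> A = [set None; Some v1; Some v4] ->
    A \in replacement @: (lost_triangles :&: replaced_triangles).
  move=> e14 eA1; apply: (inR [set v1; v2; v4]);
    rewrite ?eA1 ?triangle3 ?subUset ?sub1set ?inE ?eqxx ?orbT //.
  rewrite /replacement !inE !eqxx !orbT /= (setUC [set v1] [set v2]) -[in RHS]setUA.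
  rewrite setU1K.
    by rewrite imsetU1 imset_set1 setUA.
  by rewrite !inE negb_or d24 eq_sym d12.
have p34 : adj v3 v4 -> A = [set None; Some v3; Some v4] ->
    A \in replacement @: (lost_triangles :&: replaced_triangles).
  move=> e34 eA1; apply: (inR [set v2; v3; v4]);
    rewrite ?eA1 ?triangle3 ?subUset ?sub1set ?inE ?eqxx ?orbT //.
  rewrite /replacement !inE !eqxx !orbT /= -[in RHS]setUA setU1K.
    by rewrite imsetU1 imset_set1 setUA.
  by rewrite !inE negb_or d24 d23.
have eA' : A = [set None; Some z; Some y] by rewrite eA -setUA (setUC [set Some y]) setUA.
have zy := yz; rewrite adj_sym in zy; have adjzy := adjyz; rewrite adj_sym in adjzy.
move: oy oz; rewrite /= !inE -!orbA => /or4P[]/eqP ey /or4P[]/eqP ez;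
  rewrite ?ey ?ez in adjyz adjzy yz zy eA eA';
  by [rewrite adj_irrefl in adjyz | case/negP: n13 | case/negP: n24
     | left | right; apply: p23 | right; apply: p14 | right; apply: p34].
Qed.

(** For empty [X] this says that the level does not decrease; every triangle in
    [X] is lost for good, and raises the level by one more. *)
Lemma dte_triangles_le (X : {set {set G}}) :
  X \subset lost_triangles :\: replaced_triangles ->
  num_triangles (dte v1 v2 v3 v4) + #|X| <= (num_triangles G).+1.
Proof.
move=> XL; have cT : num_triangles G = #|kept_triangles| + #|lost_triangles|.
  rewrite -[num_triangles G](cardsID [set A : {set G} |
    ([set v1; v3] \subset A) || ([set v2; v4] \subset A)]).
  rewrite addnC; congr (_ + _); apply: eq_card => A; rewrite !inE //.
  by rewrite andbC.
have cH : num_triangles (dte v1 v2 v3 v4) <=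
    1 + (#|kept_triangles| + #|lost_triangles :&: replaced_triangles|).
  apply: leq_trans (subset_leq_card dte_triangles_cover) _.
  rewrite cardsU1 leq_add ?leq_b1 // (leq_trans (leq_card_setU _ _)) //.
  by rewrite leq_add ?leq_imset_card.
have := subset_leq_card XL; have := cardsID replaced_triangles lost_triangles.
lia.
Qed.

End Counting.

(** * Expanding a zigzag graph at consecutive vertices *)

Lemma set2_eq (T : finType) (a b c d : T) : ([set a; b] == [set c; d]) =
  ((a == c) && (b == d)) || ((a == d) && (b == c)).
Proof.
apply/eqP/orP => [eqS|[]/andP[/eqP-> /eqP->] //]; last by rewrite setUC.
have: (a \in [set c; d]) && (b \in [set c; d]) by rewrite -eqS set21 set22.
have: (c \in [set a; b]) && (d \in [set a; b]) by rewrite eqS set21 set22.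
rewrite !in_set2 !(eq_sym c) !(eq_sym d).
move=> h1 h2; apply/orP; move: h1 h2.
by move: (a == c) (a == d) (b == c) (b == d) => [] [] [] [].
Qed.

(** Inserting the new vertex between v2 and v3 in the cycle puts v1, v2, v3, v4
    within two steps of it and pushes exactly the pairs v1v3 and v2v4, formerly
    two steps apart, to three steps.  At least five vertices are needed so that
    these two pairs are not also joined around the other side of the cycle. *)
Lemma zigzag_insert (G : sgraph) (s : G -> G) (v1 v2 v3 v4 : G) :
  5 <= #|G| -> zigzag_cycle s -> v2 = s v1 -> v3 = s v2 -> v4 = s v3 ->
  zigzag (dte v1 v2 v3 v4).
Proof.
move=> n5 [cyc adjs] e2 e3 e4; have injs := cycle_inj cyc.
have D x i j : i < 5 -> j < 5 -> i != j -> iter i s x != iter j s x.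
  by move=> i5 j5; rewrite (eq_iter_cycle cyc) // ?(leq_trans _ n5).
have d12 : v1 != v2 by rewrite e2; apply: (D v1 0 1).
have d13 : v1 != v3 by rewrite e3 e2; apply: (D v1 0 2).
have d14 : v1 != v4 by rewrite e4 e3 e2; apply: (D v1 0 3).
have d23 : v2 != v3 by rewrite e3 e2; apply: (D v1 1 2).
have d24 : v2 != v4 by rewrite e4 e3 e2; apply: (D v1 1 3).
have d34 : v3 != v4 by rewrite e4 e3 e2; apply: (D v1 2 3).
have d15 : v1 != s v4 by rewrite e4 e3 e2; apply: (D v1 0 4).
have d25 : v2 != s v4 by rewrite e4 e3 e2; apply: (D v1 1 4).
have d26 : v2 != s (s v4) by rewrite e4 e3 e2; apply: (D (s v1) 0 4).
split; first by rewrite card_option leqW.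
(* The new cycle, in which [None] follows v2 and precedes v3. *)
pose s' (o : option G) : option G :=
  if o is Some u then if u == v2 then None else Some (s u) else Some v3.
exists s'; split.
  have s'1 u : fconnect s' (Some u) (Some (s u)).
    have [->|nu] := eqVneq u v2; last by apply: connect1; rewrite /frel /= (negPf nu).
    apply: (@connect_trans _ _ None); apply: connect1; rewrite /frel /= ?eqxx //.
    by rewrite e3.
  have s'G u w : fconnect s' (Some u) (Some w).
    have [i _ ->] := cycle_iter cyc u w; elim: i => //= i IH.
    exact: connect_trans IH (s'1 _).
  have to u : fconnect s' (Some u) None.
    by apply: connect_trans (s'G u v2) _; apply: connect1; rewrite /frel /= eqxx.
  have from u : fconnect s' None (Some u).
    by apply: connect_trans (s'G v3 u); apply: connect1; rewrite /frel /=.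
  by move=> [u|] [w|].
have someE (a b : G) : (Some a == Some b) = (a == b) by [].
have aheadG u w : ahead2 s' (Some u) (Some w) = [&& ahead2 s u w,
    ~~ ((u == v1) && (w == v3)) & ~~ ((u == v2) && (w == v4))].
  rewrite /ahead2 /s'.
  have [->|n2] := eqVneq u v2.
    rewrite -e3 -e4 (eq_sym v2) (negPf d12) /=.
    by rewrite someE; have [->|] := eqVneq w v3; rewrite ?d34 //= andbN.
  have [->|n1] := eqVneq u v1.
    rewrite -e2 -e3 eqxx !orbF /=.
    by rewrite someE; have [->|] := eqVneq w v2; rewrite ?d23 //= ?andbT andbN.
  by rewrite [in X in if X then _ else _]e2 (inj_eq injs) (negPf n1) /= andbT.
have aheadN u : ahead2 s' None (Some u) = (u == v3) || (u == v4).
  by rewrite /ahead2 /= (eq_sym v3 v2) (negPf d23) -e4.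
have aheadNV u : ahead2 s' (Some u) None = (u == v1) || (u == v2).
  rewrite /ahead2 /=; have [->|n2] := eqVneq u v2; first by rewrite orbT.
  by rewrite /= {1}e2 (inj_eq injs) orbF; case: (u == v1).
move=> [u|] [w|].
- rewrite !aheadG [adj _ _]/= adjs !set2_eq.
  (* The deleted edges are ordered pairs of the cycle in one direction only:
     neither v1 after v3 nor v2 after v4 is at most two steps ahead. *)
  have back a b : ~~ (ahead2 s a b && ((a == v3) && (b == v1))) &&
      ~~ (ahead2 s a b && ((a == v4) && (b == v2))).
    rewrite -negb_or; apply/negP => /orP[]/and3P[+ /eqP ea /eqP eb];
      rewrite ea eb /ahead2 -?e4.
      by rewrite (negPf d14) (negPf d15).
    by rewrite (negPf d25) (negPf d26).
  have := back u w; have := back w u; rewrite !(andbC (w == _)).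
  move: (ahead2 s u w) (ahead2 s w u) ((u == v1) && _) ((u == v2) && _)
    ((u == v3) && _) ((u == v4) && _).
  by move=> [] [] [] [] [] [].
- transitivity (u \in [set v1; v2; v3; v4]); first by [].
  by rewrite aheadN aheadNV !inE -!orbA.
- transitivity (w \in [set v1; v2; v3; v4]); first by [].
  by rewrite aheadN aheadNV orbC !inE -!orbA.
by rewrite /ahead2 /= (eq_sym v3 v2) (negPf d23).
Qed.

Lemma zigzag_insert_opp (G : sgraph) (s : G -> G) (v1 v2 v3 v4 : G) :
  5 <= #|G| -> zigzag_cycle s -> v2 = s v1 -> v3 = s v2 -> v4 = s v3 ->
  zigzag (dte v4 v3 v2 v1).
Proof.
move=> n5 zs e2 e3 e4; have injs := cycle_inj zs.1.
apply: (zigzag_insert n5 (zigzag_cycle_finv zs)); by rewrite ?e4 ?e3 ?e2 finv_f.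
Qed.

Lemma dte_swap (G : sgraph) (v1 v2 v3 v4 : G) :
  isomorphic (dte v3 v2 v1 v4) (dte v1 v2 v3 v4).
Proof.
exists id; first by exists id.
have e : [set v3; v2; v1; v4] = [set v1; v2; v3; v4].
  apply/setP=> x; rewrite !inE.
  by move: (x == v1) (x == v2) (x == v3) (x == v4) => [] [] [] [].
move=> [u|] [w|] //=; rewrite /adj /= ?e //.
by rewrite (setUC [set v3]).
Qed.

(** * Zigzag graphs on five and six vertices *)

(** Two points of a cycle of length n, at positions i <= j, are within two steps
    of each other either directly or around the end of the cycle. *)
Lemma ahead2_iter_cycle (T : finType) (s : T -> T) x i j :
  (forall x y, fconnect s x y) -> 2 < #|T| -> i <= j < #|T| ->
  ahead2 s (iter i s x) (iter j s x) || ahead2 s (iter j s x) (iter i s x) =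
  (i != j) && ((j <= i + 2) || (i + #|T| <= j + 2)).
Proof.
move=> cyc n3 ijn.
have it a b : a < #|T| -> b < #|T| + #|T| ->
    (iter a s x == iter b s x) = (a == b) || (a + #|T| == b).
  move=> an bn; have [bn'|bn'] := ltnP b #|T|.
    by rewrite (eq_iter_cycle cyc) //; lia.
  rewrite -(subnK bn') iterD (iter_card_cycle cyc) (eq_iter_cycle cyc) //; lia.
rewrite /ahead2 -!iterS !it; lia.
Qed.

Lemma ahead2_cycle5 (T : finType) (s : T -> T) x y : (forall x y, fconnect s x y) ->
  #|T| = 5 -> ahead2 s x y || ahead2 s y x = (x != y).
Proof.
move=> cyc n5; have [i i5 ->] := cycle_iter cyc x y; rewrite n5 in i5.
have := @ahead2_iter_cycle T s x 0 i cyc; rewrite n5 /= => -> //.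
rewrite -{1}[x]/(iter 0 s x) (eq_iter_cycle cyc) ?n5 //.
lia.
Qed.

Lemma ahead2_cycle6 (T : finType) (s : T -> T) x y : (forall x y, fconnect s x y) ->
  #|T| = 6 -> ahead2 s x y || ahead2 s y x = (x != y) && (y != s (s (s x))).
Proof.
move=> cyc n6; have [i i6 ->] := cycle_iter cyc x y; rewrite n6 in i6.
have := @ahead2_iter_cycle T s x 0 i cyc; rewrite n6 /= => -> //.
rewrite -{1}[x]/(iter 0 s x) -[s (s (s x))]/(iter 3 s x) !(eq_iter_cycle cyc) ?n6 //.
lia.
Qed.

Lemma mem_uniq_full (T : finType) (p : seq T) x : uniq p -> size p = #|T| -> x \in p.
Proof.
move=> Up sp; have cT : #|p| = #|T| by rewrite (card_uniqP Up).
by rewrite (subset_cardP cT (subset_predT _)).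
Qed.

Lemma next_cycle (T : finType) (p : seq T) : uniq p -> size p = #|T| ->
  forall x y, fconnect (next p) x y.
Proof.
by move=> Up sp x y; rewrite (fconnect_cycle (cycle_next Up)) mem_uniq_full.
Qed.

(** The graph is complete, so any cyclic order of its five vertices is a zigzag
    cycle, in particular one that begins with v1, v2, v3, v4. *)
Lemma zigzag_dte5 (G : sgraph) (v1 v2 v3 v4 : G) : zigzag G -> #|G| = 5 ->
  uniq [:: v1; v2; v3; v4] -> zigzag (dte v1 v2 v3 v4).
Proof.
move=> [_ [s [cyc adjs]]] n5 uv.
have /card_gt0P[u] : 0 < #|[predC [:: v1; v2; v3; v4]]|.
  by rewrite -(ltn_add2l #|[:: v1; v2; v3; v4]|) cardC (card_uniqP uv) n5.
rewrite inE /= => nu.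
have Up : uniq (rcons [:: v1; v2; v3; v4] u) by rewrite rcons_uniq nu.
have zs : zigzag_cycle (next (rcons [:: v1; v2; v3; v4] u)).
  have cyc' := next_cycle Up (esym n5).
  by split=> // x y; rewrite adjs !ahead2_cycle5.
have /and5P[/eqP e2 /eqP e3 /eqP e4 _ _] := cycle_next Up.
by apply: (zigzag_insert _ zs); rewrite ?n5 ?e2 ?e3 ?e4.
Qed.

(** The graph is the octahedron: adjacency means distinct and not antipodal,
    where the antipode of a vertex is three steps away.  Hence any cyclic order
    a, b, c, a', b', c' with antipodes three steps apart is a zigzag cycle.  The
    vertex v4, being adjacent to v2, is the antipode of v1 or of v3; up to
    exchanging v1 and v3, the site begins such a cyclic order. *)
Lemma zigzag_dte6 (G : sgraph) (v1 v2 v3 v4 : G) : zigzag G -> #|G| = 6 ->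
  dte_site v1 v2 v3 v4 -> zigzag (dte v1 v2 v3 v4).
Proof.
move=> [_ [s [cyc adjs]]] n6 [uv t123 e24]; pose opp x := s (s (s x)).
have oppK : involutive opp.
  by move=> x; have := iter_card_cycle cyc x; rewrite n6.
have adjE x y : adj x y = (x != y) && (y != opp x) by rewrite adjs ahead2_cycle6.
have neqo x : (x == opp x) = false.
  by rewrite /opp -{1}[x]/(iter 0 s x) (@eq_iter_cycle _ _ cyc x 0 3) ?n6.
have eqo x y : (opp x == y) = (x == opp y) by rewrite -(inj_eq (can_inj oppK)) oppK.
have Up a b c : adj a b -> adj b c -> adj a c ->
    uniq [:: a; b; c; opp a; opp b; opp c].
  rewrite !adjE => /andP[/negPf nab /negPf nab'] /andP[/negPf nbc /negPf nbc'].
  move=> /andP[/negPf nac /negPf nac'].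
  rewrite /= !inE !negb_or !neqo nab nac nbc !(inj_eq (can_inj oppK)) nab nac nbc.
  have sym u w : (w == opp u) = false -> (u == opp w) = false.
    by rewrite -eqo eq_sym.
  by rewrite (sym _ _ nab') (sym _ _ nac') (sym _ _ nbc') nab' nac' nbc'.
have core a b c : adj a b -> adj b c -> adj a c -> zigzag (dte a b c (opp a)).
  move=> ab bc ac; have U := Up a b c ab bc ac.
  have cyc' := next_cycle U (esym n6).
  have /and5P[/eqP e2 /eqP e3 /eqP e4 /eqP e5 /and3P[/eqP e6 /eqP e1 _]] := cycle_next U.
  apply: (@zigzag_insert _ (next [:: a; b; c; opp a; opp b; opp c])) => //.
    by rewrite n6.
  split=> // x y; rewrite adjE ahead2_cycle6 //; congr (_ && (_ != _)).
  have := mem_uniq_full x U (esym n6); rewrite !inE.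
  case/or4P => [/eqP->|/eqP->|/eqP->|/or3P[]/eqP->];
    by rewrite ?e1 ?e2 ?e3 ?e4 ?e5 ?e6 ?e1 ?e2 ?e3 ?oppK.
have adjA a b : a \in [set v1; v2; v3] -> b \in [set v1; v2; v3] -> a != b -> adj a b.
  exact: mem_triangle_adj t123.
move: uv; rewrite /= !inE !negb_or !andbT.
case/and3P=> /and3P[d12 d13 d14] /andP[d23 d24] d34.
have [e12 e13 e23] : [/\ adj v1 v2, adj v1 v3 & adj v2 v3].
  by split; apply: adjA; rewrite ?inE ?eqxx ?orbT.
have := mem_uniq_full v4 (Up _ _ _ e12 e23 e13) (esym n6).
rewrite !inE !(eq_sym v4) (negPf d14) (negPf d24) (negPf d34) /=.
case/or3P=> /eqP e4; rewrite -e4 in e24 *.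
- exact: core.
- by rewrite adjE eqxx andbF in e24.
by apply: (zigzag_iso (dte_swap _ _ _ _)); apply: core; rewrite // adj_sym.
Qed.

(** * Zigzag graphs on at least seven vertices *)

(** With at least seven vertices, positions at most four apart are not within two
    steps around the other side of the cycle, so adjacency is read off from the
    positions in a window of the cycle. *)
Lemma zigzag_adj_iter (G : sgraph) (s : G -> G) b i j : 7 <= #|G| ->
  zigzag_cycle s -> i < #|G| -> j < #|G| -> i <= j + 4 -> j <= i + 4 ->
  adj (iter i s b) (iter j s b) = [&& i != j, i <= j + 2 & j <= i + 2].
Proof.
move=> n7 [cyc adjs] iG jG ij ji; rewrite adjs.
have [le_ij|/ltnW le_ji] := leqP i j; last rewrite orbC.
  rewrite ahead2_iter_cycle //; lia.
rewrite ahead2_iter_cycle //; lia.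
Qed.

Lemma zigzag_nbr (G : sgraph) (s : G -> G) k b y : zigzag_cycle s ->
  adj (iter k.+2 s b) y ->
  exists2 i : nat, i \in [:: k; k.+1; k.+3; k.+4] & y = iter i s b.
Proof.
move=> [cyc adjs]; have injs := cycle_inj cyc; rewrite adjs => /orP[] /orP[] /eqP e.
- by exists k.+3; rewrite ?inE ?eqxx ?orbT.
- by exists k.+4; rewrite ?inE ?eqxx ?orbT.
- by exists k.+1; rewrite ?inE ?eqxx ?orbT //; apply/injs.
- by exists k; rewrite ?inE ?eqxx ?orbT //; do 2 apply/injs.
Qed.

Lemma zigzag_triangle (G : sgraph) (s : G -> G) (A : {set G}) : 7 <= #|G| ->
  zigzag_cycle s -> is_triangle A -> exists x, A = [set x; s x; s (s x)].
Proof.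
move=> n7 zs; case/triangleP=> x [y [z [+ + + ->]]].
have [b ->] := cycle_iterV zs.1 2 x.
move=> /(zigzag_nbr zs)[i Ii ->] /(zigzag_nbr zs)[j Ij ->].
wlog ij : i j Ii Ij / i <= j.
  have [|/ltnW ij] := leqP i j; first by auto.
  by move=> W; rewrite adj_sym => /(W j i Ij Ii ij)[t et]; exists t; rewrite -et setUAC.
rewrite zigzag_adj_iter //; try by move: Ii Ij; rewrite !inE; lia.
move: Ii Ij ij; rewrite !inE.
case/or4P=> /eqP->; case/or4P=> /eqP-> //= _ _.
- by exists b; rewrite -setUA setUC.
- by exists (s b); rewrite (setUC [set s (s b)]).
- by exists (s (s b)).
Qed.

Lemma num_triangles_zigzag_le (G : sgraph) : zigzag G -> 7 <= #|G| ->
  num_triangles G <= #|G|.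
Proof.
move=> [_ [s zs]] n7.
apply: leq_trans (leq_imset_card (fun x => [set x; s x; s (s x)]) G).
apply/subset_leq_card/subsetP => A; rewrite inE => tA.
by have [x ->] := zigzag_triangle n7 zs tA; apply: imset_f.
Qed.

(** A triple of consecutive vertices determines its first vertex because the
    cycle has length at least five. *)
Lemma num_triangles_zigzag_ge (G : sgraph) : zigzag G -> #|G| <= num_triangles G.
Proof.
move=> [n5 [s [cyc adjs]]].
have D x i : 0 < i < 5 -> (x == iter i s x) = false.
  move=> i5; rewrite -{1}[x]/(iter 0 s x) (eq_iter_cycle cyc) //; lia.
have inj : injective (fun x => [set x; s x; s (s x)]).
  move=> t u eqT; apply/eqP.
  have := set11 t; have : t \in [set u; s u; s (s u)].
    by rewrite -eqT !inE eqxx.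
  have : u \in [set t; s t; s (s t)] by rewrite eqT !inE eqxx.
  rewrite !inE -!orbA => /or3P[]/eqP ut //; first by rewrite ut eqxx.
    rewrite ut (D t 1) // (D t 2) // (D t 3) //.
  by rewrite ut (D t 2) // (D t 3) // (D t 4).
rewrite -(card_imset G inj); apply/subset_leq_card/subsetP => A /imsetP[x _ ->].
by rewrite inE triangle3 // adjs /ahead2 eqxx ?orbT.
Qed.

(** Place v2 at position 3, so that v1, v3 and v4 are among positions 1, 2, 4, 5.
    As v1 and v3 are adjacent, they occupy 2 and 4, 1 and 2, or 4 and 5.  In the
    first case the site is consecutive.  In the second case, position 0 forms a
    triangle with v1 and v3, and the one of the positions 4, 5 that is not v4
    forms a triangle with v2 and v4; both triangles are lost.  The third case is
    the mirror image of the second. *)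
Lemma zigzag_dte7 (G : sgraph) (v1 v2 v3 v4 : G) : zigzag G -> 7 <= #|G| ->
  dte_site v1 v2 v3 v4 ->
  zigzag (dte v1 v2 v3 v4) \/ (num_triangles (dte v1 v2 v3 v4)).+2 <= #|G|.+1.
Proof.
move=> zG n7 site; have leG := num_triangles_zigzag_le zG n7.
have [n5 [s zs]] := zG; have [cyc adjs] := zs.
have [uv t123 e24] := site.
have [two|] := boolP [exists A, exists B, (A != B) && ([set A; B] \subset
    lost_triangles v1 v2 v3 v4 :\: replaced_triangles v1 v2 v3 v4)].
  right; have /existsP[A /existsP[B /andP[nAB sAB]]] := two.
  have := dte_triangles_le site sAB; rewrite cards2 nAB; lia.
move=> few; left.
have adjA a b : a \in [set v1; v2; v3] -> b \in [set v1; v2; v3] -> a != b -> adj a b.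
  exact: mem_triangle_adj t123.
move: uv; rewrite /= !inE !negb_or !andbT.
case/and3P=> /and3P[d12 d13 d14] /andP[d23 d24] d34.
have [e21 e13 e23] : [/\ adj v2 v1, adj v1 v3 & adj v2 v3].
  by split; apply: adjA; rewrite ?inE ?eqxx ?orbT // eq_sym.
have [b e2] := cycle_iterV cyc 3 v2.
(* The triangles x v1 v3 and y v2 v4 would be two unreplaced losses. *)
have wit x y : adj x v1 -> adj x v3 -> x != v2 -> adj y v2 -> adj y v4 ->
    y != v1 -> y != v3 -> False.
  move=> x1 x3 nx2 y2 y4 ny1 ny3; case/negP: few.
  apply/existsP; exists [set x; v1; v3]; apply/existsP; exists [set y; v2; v4].
  apply/andP; split.
    apply: contraNneq nx2 => e.
    have : v2 \in [set x; v1; v3] by rewrite e !inE eqxx !orbT.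
    by rewrite !inE (eq_sym v2 v1) (negPf d12) (negPf d23) !orbF eq_sym.
  have v2A : v2 \notin [set x; v1; v3].
    by rewrite !inE !negb_or (eq_sym v2 x) nx2 (eq_sym v2 v1) d12 d23.
  have v4B : v4 \notin [set v1; v2; v3].
    by rewrite !inE !negb_or !(eq_sym v4) d14 d24 d34.
  have yB : (y \notin [set v1; v2; v4]) && (y \notin [set v2; v3; v4]).
    by rewrite !inE !negb_or ny1 ny3 (adj_neq y2) (adj_neq y4).
  have neqS (u : G) (C D : {set G}) : u \in C -> u \notin D -> C != D.
    by move=> uC; apply: contraNneq => <-.
  rewrite subUset !sub1set !inE !negb_or !triangle3 //= !subUset !sub1set !inE.
  rewrite !eqxx !orbT !andbT /=; case/andP: yB => yB1 yB2.
  apply/andP; split.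
    by rewrite -!(eq_sym _ [set x; v1; v3]) !(neqS v2) // !inE eqxx ?orbT.
  by rewrite (neqS v4) ?(neqS y) // !inE eqxx ?orbT.
have eqp i j : i < 7 -> j < 7 -> (iter i s b == iter j s b) = (i == j).
  by move=> i7 j7; rewrite (eq_iter_cycle cyc) ?(leq_trans _ n7).
have adjp i j : i < 7 -> j < 7 -> i <= j + 4 -> j <= i + 4 ->
    adj (iter i s b) (iter j s b) = [&& i != j, i <= j + 2 & j <= i + 2].
  by move=> i7 j7; apply: (zigzag_adj_iter b n7 zs); rewrite (leq_trans _ n7).
have nbr y : adj v2 y -> exists2 i : nat, i \in [:: 1; 2; 4; 5] & y = iter i s b.
  by rewrite e2; apply: zigzag_nbr.
have [i1 I1 e1] := nbr _ e21; have [i3 I3 e3] := nbr _ e23.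
have [i4 I4 e4] := nbr _ e24.
have below i : i \in [:: 1; 2; 4; 5] -> i < 7 by rewrite !inE; case/or4P=> /eqP->.
have {}d14 : i1 != i4 by rewrite e1 e4 eqp ?below in d14.
have {}d34 : i3 != i4 by rewrite e3 e4 eqp ?below in d34.
have {}e13 : [&& i1 != i3, i1 <= i3 + 2 & i3 <= i1 + 2].
  have [le13 le31] : i1 <= i3 + 4 /\ i3 <= i1 + 4.
    by move: I1 I3; rewrite !inE => /or4P[]/eqP-> /or4P[]/eqP->.
  by rewrite e1 e3 adjp ?below // in e13.
clear nbr few below.
move: I1 I3 I4 d14 d34 e13; rewrite !inE.
case/or4P=> /eqP E1; case/or4P=> /eqP E3; case/or4P=> /eqP E4; rewrite {}E1 {}E3 {}E4 //
  in e1 e3 e4 * => _ _ _; rewrite {}e1 {}e2 {}e3 {}e4 in wit *.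
- by case: (wit (iter 0 s b) (iter 5 s b)); rewrite ?adjp ?eqp.
- by case: (wit (iter 0 s b) (iter 4 s b)); rewrite ?adjp ?eqp.
- by case: (wit (iter 0 s b) (iter 5 s b)); rewrite ?adjp ?eqp.
- by case: (wit (iter 0 s b) (iter 4 s b)); rewrite ?adjp ?eqp.
- by apply: (zigzag_iso (dte_swap _ _ _ _)); apply: (zigzag_insert_opp n5 zs).
- exact: (zigzag_insert n5 zs).
- exact: (zigzag_insert_opp n5 zs).
- by apply: (zigzag_iso (dte_swap _ _ _ _)); apply: (zigzag_insert n5 zs).
- by case: (wit (iter 6 s b) (iter 2 s b)); rewrite ?adjp ?eqp.
- by case: (wit (iter 6 s b) (iter 1 s b)); rewrite ?adjp ?eqp.
- by case: (wit (iter 6 s b) (iter 2 s b)); rewrite ?adjp ?eqp.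
- by case: (wit (iter 6 s b) (iter 1 s b)); rewrite ?adjp ?eqp.
Qed.

(** * The dichotomy *)

Lemma zigzag_complete5 : zigzag (complete 5).
Proof.
have n5 : #|complete 5| = 5 by rewrite card_ord.
split; first by rewrite n5.
have Up := enum_uniq (complete 5); have sp : size (enum (complete 5)) = #|complete 5|.
  by rewrite cardE.
have cyc := next_cycle Up sp.
by exists (next (enum (complete 5))); split=> // x y; rewrite ahead2_cycle5.
Qed.

Lemma K5_descendant_dichotomy (G : sgraph) :
  K5_descendant G -> zigzag G \/ (num_triangles G).+2 <= #|G|.
Proof.
elim=> {G} [H iso5|G H v1 v2 v3 v4 _ IH _ site isoH].
  by left; apply: zigzag_iso iso5 zigzag_complete5.
have cardH : #|H| = #|G|.+1.
  by case: isoH => f bijf _; rewrite -(bij_eq_card bijf) card_option.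
rewrite -(num_triangles_iso isoH) cardH.
case: IH => [zG|lowG]; last first.
  right; have := dte_triangles_le site (sub0set _); rewrite cards0; lia.
suff: zigzag (dte v1 v2 v3 v4) \/ (num_triangles (dte v1 v2 v3 v4)).+2 <= #|G|.+1.
  by case=> [/(zigzag_iso isoH)|]; [left | right].
have [n5 _] := zG.
have [n7|] := leqP 7 #|G|; first exact: zigzag_dte7.
rewrite ltnS leq_eqVlt => /orP[/eqP n6|lt6]; left; first exact: zigzag_dte6.
by apply: zigzag_dte5 => //; [lia | case: site].
Qed.

Theorem proposition3p4 (G : sgraph) (hG : K5_descendant G) : level G <> 1%R.
Proof.
rewrite /level; case: (K5_descendant_dichotomy hG) => [/num_triangles_zigzag_ge|]; lia.
Qed.
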